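(* Let $W$ be an irreducible and ergodic transition matrix on a finite set $\mathcal X$, let $g:\mathcal X\times\mathcal X\to\mathbb R$ be linearly independent under $W$, and let $\{W_\theta\}_{\theta\in\mathbb R}$ be the one-parameter exponential family of transition matrices generated by $W$ with the generator $g$, with potential function $\phi$. Let $\{P_\theta\}_\theta$ be a family of initial distributions on $\mathcal X$ smoothly parametrized by $\theta$. Let $J^n_\theta$ and $\tilde J^n_\theta$ be the Fisher informations of the family of distributions $\{W_\theta^{\times n}\times P_\theta\}_\theta$ on $\mathcal X^{n+1}$ for the natural parameter $\theta$ and for the expectation parameter $\eta$, respectively, at the point $\theta$. Then for every $\theta$ $$\lim_{n\to\infty}\frac{J_\theta^n}{n}=\frac{d^2\phi}{d\theta^2}(\theta),\qquad \lim_{n\to\infty}\frac{\tilde J_\theta^n}{n}=\Bigl(\frac{d^2\phi}{d\theta^2}(\theta)\Bigr)^{-1}.$$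
   Context: A transition matrix on a finite set $\mathcal X$ is a nonnegative matrix $W(x|x')$ with $\sum_x W(x|x')=1$ for every $x'$; $\mathcal X^2_W:=\{(x,x'):W(x|x')>0\}$. It acts on column vectors by $v\mapsto\sum_{x'}W(x|x')v(x')$. $W$ is irreducible if for all $x,x'$ there is $n$ with $W^n(x|x')>0$, and ergodic if it is irreducible and aperiodic. A single function $g$ is linearly independent under $W$ if there are no $f:\mathcal X\to\mathbb R$ and $c\in\mathbb R$ with $g(x,x')=f(x)-f(x')+c$ for all $(x,x')\in\mathcal X_W^2$. One-parameter exponential family: for $\theta\in\mathbb R$ let $\overline W_\theta(x|x'):=W(x|x')e^{\theta g(x,x')}$, let $\lambda_\theta$ be its Perron–Frobenius eigenvalue, $\phi(\theta):=\log\lambda_\theta$, and $\overline P^3_\theta$ the positive Perron–Frobenius eigenvector of $\overline W_\theta^T$. Put $W_\theta(x|x'):=\lambda_\theta^{-1}\overline P^3_\theta(x)\overline W_\theta(x|x')\overline P^3_\theta(x')^{-1}$. $\theta$ is the natural parameter and $\eta(\theta):=\frac{d\phi}{d\theta}(\theta)$ the expectation parameter; $\frac{d^2\phi}{d\theta^2}(\theta)>0$ for all $\theta$. $W_\theta^{\times n}\times P_\theta(x_{n+1},\dots,x_1):=W_\theta(x_{n+1}|x_n)\cdots W_\theta(x_2|x_1)P_\theta(x_1)$. Fisher information is the expectation of the squared derivative of the log-likelihood, taken over the support of the distribution. *)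

(* Defs.v *)
From HB Require Import structures.
From mathcomp Require Export all_boot all_order all_algebra.
From mathcomp Require Export complex.
From mathcomp Require Export all_classical all_reals all_analysis.
Export Order.TTheory GRing.Theory Num.Theory.
Export numFieldNormedType.Exports.

#[export] Set Implicit Arguments.
#[export] Unset Strict Implicit.
#[export] Unset Printing Implicit Defensive.

Local Open Scope classical_set_scope.
Local Open Scope ring_scope.

(* Throughout, a kernel [W : X -> X -> R] is read as [W x x'] = W(x|x'): the
   first argument is the arrival state, the second one the departure state. *)

Section TransitionMatrices.
Variables (R : realType) (X : finType).
Implicit Types (W g : X -> X -> R) (p : X -> R).

Definition distribution p := (forall x, 0 <= p x) /\ \sum_x p x = 1.

Definition transition_matrix W := forall x', distribution (W ^~ x').

Definition mx_of_kernel W : 'M[R]_#|X| :=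
  \matrix_(i, j) W (enum_val i) (enum_val j).

Definition kernel_pow W (n : nat) (x x' : X) : R :=
  (mx_of_kernel W ^+ n) (enum_rank x) (enum_rank x').

Definition irreducible_kernel W :=
  forall x x', exists n, 0 < kernel_pow W n x x'.

(* the set of return times to x has gcd 1 *)
Definition aperiodic_kernel W :=
  forall x (d : nat),
    (forall n, (0 < n)%N -> 0 < kernel_pow W n x x -> (d %| n)%N) -> d = 1%N.

Definition ergodic_kernel W := irreducible_kernel W /\ aperiodic_kernel W.

Definition linearly_independent_under W g :=
  ~ exists (f : X -> R) (c : R),
      forall x x', 0 < W x x' -> g x x' = f x - f x' + c.

End TransitionMatrices.

Section PerronFrobenius.
Variables (R : realType) (n : nat).
Implicit Types A : 'M[R]_n.

(* [eigenvalue] refers to row vectors; a matrix and its transpose have the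
   same eigenvalues. The inequality is in the partial order of R[i]. *)
Definition is_pf_eigenvalue A (r : R) :=
  eigenvalue A r /\
  forall z : R[i], eigenvalue (map_mx (real_complex R) A) z ->
    `|z| <= real_complex R r.

Definition pf_eigenvalue A : R := xget 0 [set r | is_pf_eigenvalue A r].

(* For nonnegative irreducible A this vector is unique up to a positive factor;
   an arbitrary representative is chosen. *)
Definition pf_eigenvector A : 'cV[R]_n :=
  xget 0 [set v : 'cV[R]_n |
    (forall i, 0 < v i 0) /\ A *m v = pf_eigenvalue A *: v].

End PerronFrobenius.

Section ExponentialFamily.
Variables (R : realType) (X : finType).
Variables W g : X -> X -> R.

Definition tilted_kernel (t : R) (x x' : X) : R := W x x' * expR (t * g x x').

Definition pf_lambda (t : R) : R := pf_eigenvalue (mx_of_kernel (tilted_kernel t)).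

Definition potential (t : R) : R := ln (pf_lambda t).

Definition pf_P3 (t : R) (x : X) : R :=
  pf_eigenvector (mx_of_kernel (tilted_kernel t))^T (enum_rank x) 0.

(* Invariant under rescaling of [pf_P3 t], hence independent of the
   representative chosen in [pf_eigenvector]. *)
Definition exp_family (t : R) (x x' : X) : R :=
  (pf_lambda t)^-1 * pf_P3 t x * tilted_kernel t x x' * (pf_P3 t x')^-1.

Definition expectation_param : R -> R := derive1 potential.

(* Inverse of the change of parameter; 0 outside the range of
   [expectation_param]. *)
Definition natural_param_of (e : R) : R :=
  xget 0 [set t | expectation_param t = e].

End ExponentialFamily.

(* [w] lists the states x_1, ..., x_(n+1) in chronological order. *)
Definition markov_dist (R : realType) (X : finType) (n : nat)
    (V : X -> X -> R) (p : X -> R) (w : n.+1.-tuple X) : R :=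
  p (tnth w ord0) *
  \prod_(i < n) V (tnth w (lift ord0 i)) (tnth w (widen_ord (leqnSn n) i)).

Definition fisher_information (R : realType) (T : finType)
    (q : R -> T -> R) (t : R) : R :=
  \sum_(w | 0 < q t w) q t w * (derive1 (fun s => ln (q s w)) t) ^+ 2.

Definition smooth (R : realType) (f : R -> R) :=
  forall (k : nat) (t : R), derivable (derive1n k f) t 1.

(* J^n: Fisher information at [t] in the natural parameter *)
Definition fisher_natural (R : realType) (X : finType) (W g : X -> X -> R)
    (P : R -> X -> R) (n : nat) (t : R) : R :=
  fisher_information
    (fun s => markov_dist (n := n) (exp_family W g s) (P s)) t.

(* \tilde J^n: the same family reparametrized by eta, at the point eta(t) *)
Definition fisher_expectation (R : realType) (X : finType) (W g : X -> X -> R)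
    (P : R -> X -> R) (n : nat) (t : R) : R :=
  fisher_information
    (fun e => let s := natural_param_of W g e in
              markov_dist (n := n) (exp_family W g s) (P s))
    (expectation_param W g t).

(* Main.v *)
(* Write V_s for the transition matrices of the family and h_s for the
   logarithmic derivative in s of their entries. With q_s the Perron-Frobenius
   vector of total mass 1 and a_s the derivative of ln q_s,
     h_s(x,x') = g(x,x') - eta(s) + a_s(x) - a_s(x').
   Differentiating sum_x V_s(x|x') = 1 once shows that the h_s are martingale
   differences along the chain; differentiating twice gives
     sum_x V_s(x|x') (h_s(x,x')^2 + a_s'(x)) = eta'(s) + a_s'(x'),
   so the conditional variances of the increments of the score telescope and
   J^n differs from n eta'(s) by a bounded amount. At a minimum
   of a_s' the same equation gives eta' > 0, hence eta is injective with a
   differentiable inverse, and the second limit follows by the chain rule. The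
   regularity of the Perron-Frobenius pair comes from its simplicity, which
   makes a rank-one perturbation of A - lambda invertible. *)

Require Import Defs.
From mathcomp Require Import ring.

Local Open Scope classical_set_scope.
Local Open Scope ring_scope.

Lemma cvg_bigsum (R : realType) (T I : Type) (F : set_system T) (r : seq I)
    (f : I -> T -> R) (l : I -> R) : Filter F ->
  (forall i, f i x @[x --> F] --> l i) ->
  \sum_(i <- r) f i x @[x --> F] --> \sum_(i <- r) l i.
Proof.
move=> FF fl; elim: r => [|i r IHr].
  under eq_fun do rewrite big_nil.
  by rewrite big_nil; exact: cvg_cst.
under eq_fun do rewrite big_cons.
by rewrite big_cons; exact: cvgD.
Qed.

(** * Perron-Frobenius theory of nonnegative irreducible matrices *)

Section PerronFrobenius.
Variables (R : realType) (n : nat).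
Implicit Types (A : 'M[R]_n) (v w x : 'rV[R]_n) (r : R).

Definition nonneg_mx A := forall i j, 0 <= A i j.

Definition irreducible_mx A := forall i j, exists k, 0 < (A ^+ k) i j.

Lemma mulmx_row_ge0 A w :
  nonneg_mx A -> (forall i, 0 <= w 0 i) -> forall j, 0 <= (w *m A) 0 j.
Proof.
by move=> A0 w0 j; rewrite mxE; apply: sumr_ge0 => i _; rewrite mulr_ge0.
Qed.

Lemma nonneg_mxX A k : nonneg_mx A -> nonneg_mx (A ^+ k).
Proof.
move=> A0; elim: k => [|k IHk] i j; first by rewrite expr0 mxE ler0n.
by rewrite exprS mxE; apply: sumr_ge0 => l _; rewrite mulr_ge0.
Qed.

(** The constant is the largest ratio [w_i / x_i]; [i0] witnesses that a coordinate exists. Touching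
    at one coordinate is the device behind the comparison, uniqueness and simplicity results
    below. *)
Lemma touching_multiple (i0 : 'I_n) x w : (forall i, 0 < x 0 i) ->
  exists c i, w 0 i = c * x 0 i /\ forall j, w 0 j <= c * x 0 j.
Proof.
move=> x0; pose F i := w 0 i / x 0 i.
case: (@Order.TotalTheory.arg_maxP _ _ _ i0 xpredT F) => // i _ Fi.
exists (F i), i; split; first by rewrite /F divfK// gt_eqF.
by move=> j; rewrite -ler_pdivrMr//; exact: Fi.
Qed.

(** Collatz-Wielandt comparison. At the touching coordinate, [s w_i <= (w A)_i <= c (x A)_i <= r c
    x_i = r w_i], and [w_i] is positive. *)
Lemma subinvariant_le A x w r s : nonneg_mx A ->
  (forall i, 0 < x 0 i) -> (forall j, (x *m A) 0 j <= r * x 0 j) ->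
  (forall i, 0 <= w 0 i) -> w != 0 -> (forall j, s * w 0 j <= (w *m A) 0 j) ->
  s <= r.
Proof.
move=> A0 x0 xA w0 wN0 wA.
have /rV0Pn[i0 wi0] := wN0.
have [c [i [wi wle]]] := touching_multiple i0 w x0.
have c0 : 0 < c.
  rewrite -(pmulr_lgt0 _ (x0 i0)); apply: lt_le_trans (wle i0).
  by rewrite lt_def wi0 w0.
have : s * w 0 i <= c * (r * x 0 i).
  apply: le_trans (wA i) _; apply: (@le_trans _ _ (c * (x *m A) 0 i)).
    rewrite !mxE mulr_sumr; apply: ler_sum => k _.
    by rewrite mulrA ler_wpM2r.
  by rewrite ler_pM2l.
by rewrite wi mulrCA ler_pM2l// ler_pM2r.
Qed.

Lemma mulmx_eigenX A w r k : w *m A = r *: w -> w *m A ^+ k = r ^+ k *: w.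
Proof.
move=> wA; elim: k => [|k IHk]; first by rewrite !expr0 mulmx1 scale1r.
by rewrite exprSr mulmxA IHk -scalemxAl wA scalerA -exprSr.
Qed.

(** Some power of [A] leads from a positive coordinate of [w] to [j], and [w] is an eigenvector of
    every power. *)
Lemma nonneg_eigen_gt0 A w r : nonneg_mx A -> irreducible_mx A ->
  (forall i, 0 <= w 0 i) -> w != 0 -> w *m A = r *: w ->
  forall i, 0 < w 0 i.
Proof.
move=> A0 Air w0 /rV0Pn[i wi] wA j.
have [k Ak] := Air i j.
have : 0 < (w *m A ^+ k) 0 j.
  rewrite mxE (bigD1 i)//= ltr_wpDr//.
    by apply: sumr_ge0 => l _; rewrite mulr_ge0//; exact: nonneg_mxX.
  by rewrite mulr_gt0// lt_def wi w0.
rewrite (mulmx_eigenX _ wA) mxE => /lt0r_neq0; rewrite lt_def w0 andbT.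
by apply: contraNN => /eqP ->; rewrite mulr0.
Qed.

(** With the touching multiple, [c *: v - w] is a nonnegative eigenvector with a zero coordinate, so
    by [nonneg_eigen_gt0] it vanishes. *)
Lemma pf_eigen_unique A v w r : nonneg_mx A -> irreducible_mx A ->
  (forall i, 0 < v 0 i) -> v *m A = r *: v -> w *m A = r *: w ->
  exists c, w = c *: v.
Proof.
move=> A0 Air v0 vA wA.
have [->|/rV0Pn[i0 _]] := eqVneq w 0; first by exists 0; rewrite scale0r.
have [c [i [wi wle]]] := touching_multiple i0 w v0.
exists c; apply/eqP; apply: contraT => wcv.
have : 0 < (c *: v - w) 0 i.
  apply: (@nonneg_eigen_gt0 A _ r) => //.
  - by move=> j; rewrite !mxE subr_ge0.
  - by rewrite subr_eq0 eq_sym.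
  - by rewrite mulmxBl -scalemxAl vA wA scalerBr !scalerA mulrC.
by rewrite !mxE wi subrr ltxx.
Qed.

(** This excludes a Jordan block at [r]. At the touching coordinate the nonnegative vector
    [(c *: v - w) *m A] equals [- mu * v 0 i], so [mu <= 0]; the same argument for [- w] gives the
    other sign. *)
Lemma pf_eigen_simple A v w r mu (i0 : 'I_n) : nonneg_mx A ->
  (forall i, 0 < v 0 i) -> v *m A = r *: v -> w *m A = r *: w + mu *: v ->
  mu = 0.
Proof.
move=> A0 v0 vA.
have mu_le0 w' mu' : w' *m A = r *: w' + mu' *: v -> mu' <= 0.
  move=> wA; have [c [i [wi wle]]] := touching_multiple i0 w' v0.
  have /(_ i) : forall i, 0 <= ((c *: v - w') *m A) 0 i.
    by apply: mulmx_row_ge0 => // j; rewrite !mxE subr_ge0.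
  rewrite mulmxBl -scalemxAl vA wA !mxE wi.
  have -> : c * (r * v 0 i) - (r * (c * v 0 i) + mu' * v 0 i) = - mu' * v 0 i.
    by ring.
  by rewrite pmulr_lge0// oppr_ge0.
move=> wA; apply/eqP; rewrite eq_le (mu_le0 _ _ wA)//= -oppr_le0.
by apply: (mu_le0 (- w)); rewrite mulNmx wA opprD scalerN scaleNr.
Qed.

(* A positive combination of powers of [A]: it commutes with [A] and all its
   entries are positive. *)
Lemma irreducible_positive_commuting A : nonneg_mx A -> irreducible_mx A ->
  exists B : 'M[R]_n, A *m B = B *m A /\ forall i j, 0 < B i j.
Proof.
move=> A0 Air; have /choice[k kP] : forall p : 'I_n * 'I_n,
    exists k, 0 < (A ^+ k) p.1 p.2 by move=> p; exact: Air.
exists (\sum_p A ^+ k p); split.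
  rewrite mulmx_sumr mulmx_suml; apply: eq_bigr => p _.
  exact: (commrX _ (commr_refl A)).
move=> i j; rewrite summxE (bigD1 (i, j))//= ltr_wpDr//.
  by apply: sumr_ge0 => p _; exact: nonneg_mxX.
Qed.

Lemma positive_mulmx_gt0 (B : 'M[R]_n) w : (forall i j, 0 < B i j) ->
  (forall i, 0 <= w 0 i) -> w != 0 -> forall j, 0 < (w *m B) 0 j.
Proof.
move=> B0 w0 /rV0Pn[i wi] j; rewrite mxE (bigD1 i)//= ltr_wpDr//.
  by apply: sumr_ge0 => l _; rewrite mulr_ge0// ltW.
by rewrite mulr_gt0// lt_def wi w0.
Qed.

(** For nonnegative irreducible [A] the largest first component on this set is the Perron-Frobenius
    eigenvalue. The upper bound makes the set compact, and [collatz_bound] supplies it. *)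
Definition collatz_set A : set (R * 'rV[R]_n) :=
  [set p : R * 'rV[R]_n | [/\ 0 <= p.1 <= \sum_i \sum_j A i j,
     forall j, 0 <= p.2 0 j, \sum_j p.2 0 j = 1 &
     forall j, p.1 * p.2 0 j <= (p.2 *m A) 0 j]].

Lemma collatz_bound A r x : nonneg_mx A -> (forall j, 0 <= x 0 j) ->
  \sum_j x 0 j = 1 -> (forall j, r * x 0 j <= (x *m A) 0 j) ->
  r <= \sum_i \sum_j A i j.
Proof.
move=> A0 x0 x1 xA.
rewrite -[r]mulr1 -x1 mulr_sumr exchange_big/=; apply: ler_sum => j _.
apply: le_trans (xA j) _; rewrite mxE; apply: ler_sum => i _.
rewrite ler_piMl// -x1 (bigD1 i)//= lerDl.
exact: sumr_ge0.
Qed.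

Lemma collatz_compact A : compact (collatz_set A).
Proof.
set M := \sum_i \sum_j A i j.
have box := compact_setX (@segment_compact R 0 M)
  (@rV_compact R n (fun=> `[0, 1]%classic) (fun=> @segment_compact R 0 1)).
have sndc (j : 'I_n) : continuous (fun p : R * 'rV[R]_n => p.2 0 j).
  move=> p; apply: (@continuous_comp _ _ _ snd (fun v : 'rV[R]_n => v 0 j)).
    exact: cvg_snd.
  exact: coord_continuous.
apply: (@subclosed_compact _ _ _ _ box); last first.
  move=> [r x] [/= rM x0 x1 _]; split => [|i]/=; first by rewrite in_itv.
  rewrite in_itv/= x0/= -x1 (bigD1 i)//= lerDl.
  by apply: sumr_ge0.
have -> : collatz_set A =
    [set p : R * 'rV[R]_n | 0 <= p.1 <= M] `&`
    (\bigcap_(j in setT) [set p : R * 'rV[R]_n | 0 <= p.2 0 j]) `&`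
    [set p : R * 'rV[R]_n | \sum_j p.2 0 j = 1] `&`
    (\bigcap_(j in setT)
       [set p : R * 'rV[R]_n | 0 <= (p.2 *m A) 0 j - p.1 * p.2 0 j]).
  apply/seteqP; split => p.
    move=> [pM p0 p1 pA]; split; last by move=> j _ /=; rewrite subr_ge0.
    by split => //; split => // j _ /=.
  move=> [[[pM p0] p1] pA]; split => // j; first exact: p0.
  by rewrite -subr_ge0; exact: pA.
apply: closedI; first (apply: closedI; first apply: closedI).
- rewrite (_ : [set p : R * 'rV[R]_n | _] = fst @^-1` [set` `[0, M]]).
    apply: closed_comp; [move=> p _; exact: cvg_fst|exact: itv_closed].
  by apply/seteqP; split => p /=; rewrite in_itv.
- apply: closed_bigI => j _.
  apply: (@closed_comp _ _ (fun p : R * 'rV[R]_n => p.2 0 j) [set x | 0 <= x]).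
    by move=> p _; exact: sndc.
  exact: closed_ge.
- apply: (@closed_comp _ _ (fun p : R * 'rV[R]_n => \sum_j p.2 0 j)
    [set x | x = 1]).
    by move=> p _; apply: cvg_bigsum => j; exact: sndc.
  exact: closed_eq.
- apply: closed_bigI => j _.
  apply: (@closed_comp _ _
    (fun p : R * 'rV[R]_n => (p.2 *m A) 0 j - p.1 * p.2 0 j) [set x | 0 <= x]).
    move=> p _; apply: cvgB.
      rewrite mxE; under eq_fun do rewrite mxE.
      by apply: cvg_bigsum => k; apply: cvgM; [exact: sndc|exact: cvg_cst].
    by apply: cvgM; [exact: cvg_fst|exact: sndc].
  exact: closed_ge.
Qed.

(** Compactness gives a pair in [collatz_set A] with maximal [r], and maximality turns its
    inequality into an eigenvector equation. *)
Lemma perron_frobenius A (i0 : 'I_n) : nonneg_mx A -> irreducible_mx A ->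
  exists r v, [/\ forall i, 0 < v 0 i, \sum_i v 0 i = 1 & v *m A = r *: v].
Proof.
move=> A0 Air.
pose e : 'rV[R]_n := delta_mx 0 i0.
have e0 i : 0 <= e 0 i by rewrite mxE ler0n.
have e1 : \sum_j e 0 j = 1.
  rewrite (bigD1 i0)//= mxE !eqxx big1 ?addr0// => j ji.
  by rewrite mxE (negbTE ji) andbF.
have [[r x]] : exists2 c, c \in collatz_set A &
    forall t, t \in collatz_set A -> t.1 <= c.1.
  apply: compact_EVT_max.
  - exists (0, e); split => //=.
    + by rewrite lexx/=; apply: sumr_ge0 => i _; exact: sumr_ge0.
    + by move=> j; rewrite mul0r; exact: mulmx_row_ge0.
  - exact: collatz_compact.
  - by apply: continuous_subspaceT => p; exact: cvg_fst.
rewrite inE => -[/= /andP[r0 rM] x0 x1 xA] rmax.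
have xN0 : x != 0.
  apply: contra_eq_neq x1 => ->; rewrite big1 => [|i _]; last by rewrite mxE.
  by rewrite eq_sym oner_neq0.
suff xr : x *m A = r *: x.
  by exists r, x; split => //; exact: (nonneg_eigen_gt0 A0 Air x0 xN0 xr).
(* Otherwise a commuting positive matrix makes the inequality strict in every
   coordinate, and [r] could be increased. *)
apply/eqP; apply: contraT; rewrite -subr_eq0 => dN0; exfalso.
have [B [AB B0]] := irreducible_positive_commuting A0 Air.
pose y := x *m B.
have y0 : forall j, 0 < y 0 j := positive_mulmx_gt0 B0 x0 xN0.
have dy j : 0 < (y *m A) 0 j - r * y 0 j.
  have : 0 < ((x *m A - r *: x) *m B) 0 j.
    apply: positive_mulmx_gt0 => // i.
    by rewrite mxE [X in _ + X]mxE [X in _ - X]mxE subr_ge0.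
  by rewrite mulmxBl -mulmxA AB mulmxA -scalemxAl mxE [X in _ + X]mxE
    [X in _ - X]mxE.
pose F j := ((y *m A) 0 j - r * y 0 j) / y 0 j.
case: (@Order.TotalTheory.arg_minP _ _ _ i0 xpredT F) => // i _ Fi.
(* The least relative slack of [y]: after raising [r] by this amount the inequality still holds for
   [y], against maximality. *)
pose eps := F i.
have eps0 : 0 < eps by rewrite divr_gt0.
pose S := \sum_j y 0 j.
have S0 : 0 < S.
  rewrite /S (bigD1 i0)//= ltr_wpDr//.
  by apply: sumr_ge0 => j _; rewrite ltW.
pose z := S^-1 *: y.
have zin : (r + eps, z) \in collatz_set A.
  rewrite inE.
  have z0 j : 0 <= z 0 j by rewrite mxE mulr_ge0 ?invr_ge0 ?ltW.
  have z1 : \sum_j z 0 j = 1.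
    rewrite /z; under eq_bigr do rewrite mxE.
    by rewrite -mulr_sumr mulVf// gt_eqF.
  have zA j : (r + eps) * z 0 j <= (z *m A) 0 j.
    rewrite /z -scalemxAl [X in _ * X]mxE [X in _ <= X]mxE mulrCA.
    rewrite ler_pM2l ?invr_gt0//.
    rewrite mulrDl -lerBrDl -ler_pdivlMr//; exact: Fi.
  split => //=; rewrite addr_ge0 ?(ltW eps0)//=.
  exact: collatz_bound zA.
have := rmax _ zin; rewrite /= gerDl leNgt eps0.
by [].
Qed.

End PerronFrobenius.

(** * Spectral characterization of the Perron-Frobenius eigenvalue *)

Lemma char_poly_tr (R : comNzRingType) n (A : 'M[R]_n) :
  char_poly A^T = char_poly A.
Proof.
rewrite /char_poly -[RHS]det_tr; congr (\det _).
by rewrite /char_poly_mx linearB/= tr_scalar_mx map_trmx.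
Qed.

Lemma eigenvalue_tr (F : fieldType) n (A : 'M[F]_n) :
  eigenvalue A^T =1 eigenvalue A.
Proof. by move=> z; rewrite !eigenvalue_root_char char_poly_tr. Qed.

(** [pf_P3] is built from the transposed matrix, while the eigenvectors here are row vectors. The
    two defining predicates coincide, so [xget] makes the same choice. *)
Lemma pf_eigenvalue_tr (R : realType) n (A : 'M[R]_n) :
  pf_eigenvalue A^T = pf_eigenvalue A.
Proof.
have E : is_pf_eigenvalue A^T = is_pf_eigenvalue A.
  have EC z := eigenvalue_tr (map_mx (real_complex R) A) z.
  rewrite map_trmx in EC.
  apply/funext => r; apply/propext; rewrite /is_pf_eigenvalue eigenvalue_tr.
  have step B C : (forall z, eigenvalue (map_mx (real_complex R) B) z =
      eigenvalue (map_mx (real_complex R) C) z) ->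
    eigenvalue A r /\ (forall z, eigenvalue (map_mx (real_complex R) B) z ->
      `|z| <= real_complex R r) ->
    eigenvalue A r /\ (forall z, eigenvalue (map_mx (real_complex R) C) z ->
      `|z| <= real_complex R r).
    move=> BC [eigr rle]; split; first exact: eigr.
    by move=> z; rewrite -BC; exact: rle.
  by split; apply: step => z; rewrite EC.
by rewrite /pf_eigenvalue E.
Qed.

Section SpectralRadius.
Variables (R : realType) (n : nat).

(** By the triangle inequality the moduli of the entries of a complex eigenvector satisfy the
    hypothesis of [subinvariant_le] with [s] the modulus of [z]. *)
Lemma complex_eigenvalue_le (A : 'M[R]_n) (v : 'rV[R]_n) (r : R) (z : R[i]) :
  nonneg_mx A -> (forall i, 0 < v 0 i) -> v *m A = r *: v ->
  eigenvalue (map_mx (real_complex R) A) z -> `|z| <= real_complex R r.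
Proof.
move=> A0 v0 vA /eigenvalueP[w wA wN0].
(* The norm of [R[i]] takes values in [R[i]]; [N] is the modulus as a real number. *)
pose N (y : R[i]) := Num.sqrt (complex.Re y ^+ 2 + complex.Im y ^+ 2).
have NE y : `|y| = real_complex R (N y) by rewrite normc_def.
rewrite NE lecR; apply: (@subinvariant_le _ _ A v (\row_i N (w 0 i))) => //.
- by move=> j; rewrite vA mxE.
- by move=> i; rewrite mxE sqrtr_ge0.
- apply: contraNneq wN0 => /rowP w0; apply/eqP/rowP => i.
  have := w0 i; rewrite !mxE => Nwi.
  by apply/eqP; rewrite -normr_eq0 NE Nwi.
- move=> j; rewrite -lecR rmorphM/= !mxE -!NE -normrM.
  have /rowP/(_ j) := wA; rewrite !mxE => <-.
  apply: le_trans (ler_norm_sum _ _ _) _.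
  rewrite rmorph_sum/=; apply: ler_sum => i _.
  rewrite !mxE rmorphM/= -NE normrM ler_wpM2l//.
  by rewrite ger0_norm// lecR.
Qed.

Lemma pf_eigenvalueE (A : 'M[R]_n) (v : 'rV[R]_n) (r : R) (i0 : 'I_n) :
  nonneg_mx A -> (forall i, 0 < v 0 i) -> v *m A = r *: v ->
  pf_eigenvalue A = r.
Proof.
move=> A0 v0 vA.
have eigr : eigenvalue A r.
  apply/eigenvalueP; exists v => //; apply/rV0Pn; exists i0.
  by rewrite gt_eqF.
have rle z := @complex_eigenvalue_le A v r z A0 v0 vA.
have eigC s : eigenvalue A s ->
    eigenvalue (map_mx (real_complex R) A) (real_complex R s).
  by rewrite !eigenvalue_root_char -map_char_poly fmorph_root.
apply: xget_unique => [|s [eigs sle]]; first by split.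
apply/eqP; rewrite eq_le; apply/andP; split.
- rewrite -lecR; apply: le_trans (rle _ (eigC _ eigs)).
  by rewrite real_ler_norm// complex_real.
- rewrite -lecR; apply: le_trans (sle _ (eigC _ eigr)).
  by rewrite real_ler_norm// complex_real.
Qed.

End SpectralRadius.

(** * Entrywise calculus for matrix-valued functions *)

Section EntrywiseCalculus.
Variable R : realType.
Implicit Types (f g : R -> R) (s : R).

Lemma derivable_addf f g s : derivable f s 1 -> derivable g s 1 ->
  derivable (fun t => f t + g t) s 1.
Proof. exact: derivableD. Qed.

Lemma derivable_mulf f g s : derivable f s 1 -> derivable g s 1 ->
  derivable (fun t => f t * g t) s 1.
Proof. exact: derivableM. Qed.

Lemma is_derive_mulf f g (df dg : R) s :
  is_derive s 1 f df -> is_derive s 1 g dg ->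
  is_derive s 1 (fun t => f t * g t) (df * g s + f s * dg).
Proof.
move=> fdf gdg; apply: (@is_derive_eq _ _ _ (f * g)).
by rewrite addrC [df * _]mulrC.
Qed.

Lemma is_derive_addf f g (df dg : R) s :
  is_derive s 1 f df -> is_derive s 1 g dg ->
  is_derive s 1 (fun t => f t + g t) (df + dg).
Proof. by move=> fdf gdg; apply: (@is_derive_eq _ _ _ (f + g)). Qed.

Lemma is_derive_oppf f (df : R) s :
  is_derive s 1 f df -> is_derive s 1 (fun t => - f t) (- df).
Proof. by move=> fdf; apply: (@is_derive_eq _ _ _ (- f)). Qed.

Lemma is_derive_linear (a : R) s : is_derive s 1 (fun t : R => t * a) a.
Proof.
have Did : is_derive s (1 : R) (fun t : R => t) 1 := is_derive_id s 1.
have Dc : is_derive s (1 : R) (fun t : R => a) 0 := is_derive_cst a s 1.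
by have := is_derive_mulf Did Dc; rewrite mul1r mulr0 addr0.
Qed.

Lemma is_derive_scalef (a : R) f (df : R) s :
  is_derive s 1 f df -> is_derive s 1 (fun t => a * f t) (a * df).
Proof.
have Dc : is_derive s (1 : R) (fun t : R => a) 0 := is_derive_cst a s 1.
by move=> fdf; have := is_derive_mulf Dc fdf; rewrite mul0r add0r.
Qed.

Lemma is_derive_invf f (df : R) s : f s != 0 ->
  is_derive s 1 f df -> is_derive s 1 (fun t => (f t)^-1) (- df / f s ^+ 2).
Proof.
move=> fs0 fdf; have := is_deriveV fs0 fdf.
by rewrite scaleNr -mulNr mulrC mulrN -mulNr.
Qed.

Lemma is_derive_constant f (c df : R) s :
  (forall t, f t = c) -> is_derive s 1 f df -> df = 0.
Proof.
move=> fc; have -> : f = cst c by apply/funext.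
by move=> [_ <-]; exact: derive_cst.
Qed.

Lemma derivable_bigsum (I : Type) (r : seq I) (f : I -> R -> R) s :
  (forall i, derivable (f i) s 1) ->
  derivable (fun t => \sum_(i <- r) f i t) s 1.
Proof.
move=> df; elim: r => [|i r IHr].
  by under eq_fun do rewrite big_nil; exact: derivable_cst.
by under eq_fun do rewrite big_cons; apply: derivable_addf; [exact: df|].
Qed.

Lemma derivable_bigprod (I : Type) (r : seq I) (f : I -> R -> R) s :
  (forall i, derivable (f i) s 1) ->
  derivable (fun t => \prod_(i <- r) f i t) s 1.
Proof.
move=> df; elim: r => [|i r IHr].
  by under eq_fun do rewrite big_nil; exact: derivable_cst.
by under eq_fun do rewrite big_cons; apply: derivable_mulf; [exact: df|].
Qed.

Lemma is_derive_bigsum (I : Type) (r : seq I) (f : I -> R -> R)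
    (df : I -> R) s :
  (forall i, is_derive s 1 (f i) (df i)) ->
  is_derive s 1 (fun t => \sum_(i <- r) f i t) (\sum_(i <- r) df i).
Proof.
move=> fdf; elim: r => [|i r IHr].
  by under eq_fun do rewrite big_nil; rewrite big_nil; exact: is_derive_cst.
by under eq_fun do rewrite big_cons; rewrite big_cons; exact: is_deriveD.
Qed.

Definition mx_derivable m n (F : R -> 'M[R]_(m, n)) s :=
  forall i j, derivable (fun t => F t i j) s 1.

Lemma mx_derivable_cst m n (B : 'M[R]_(m, n)) s : mx_derivable (fun=> B) s.
Proof. by move=> i j; exact: derivable_cst. Qed.

Lemma mx_derivableB m n (F G : R -> 'M[R]_(m, n)) s :
  mx_derivable F s -> mx_derivable G s -> mx_derivable (fun t => F t - G t) s.
Proof.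
move=> dF dG i j; under eq_fun do rewrite mxE [X in _ + X]mxE.
exact: derivableB.
Qed.

Lemma mx_derivableM m n p (F : R -> 'M[R]_(m, n)) (G : R -> 'M[R]_(n, p)) s :
  mx_derivable F s -> mx_derivable G s -> mx_derivable (fun t => F t *m G t) s.
Proof.
move=> dF dG i j; under eq_fun do rewrite mxE.
by apply: derivable_bigsum => k; exact: derivable_mulf.
Qed.

Lemma mx_derivableZ m n (c : R -> R) (F : R -> 'M[R]_(m, n)) s :
  derivable c s 1 -> mx_derivable F s -> mx_derivable (fun t => c t *: F t) s.
Proof.
move=> dc dF i j; under eq_fun do rewrite mxE.
by apply: derivable_mulf; [exact: dc|exact: dF].
Qed.

Lemma mx_derivable_scalar n (c : R -> R) s :
  derivable c s 1 -> mx_derivable (fun t => (c t)%:M : 'M[R]_n) s.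
Proof.
move=> dc i j; under eq_fun do rewrite mxE.
by case: (i == j); [exact: dc|exact: derivable_cst].
Qed.

Lemma derivable_det n (F : R -> 'M[R]_n) s :
  mx_derivable F s -> derivable (fun t => \det (F t)) s 1.
Proof.
move=> dF; apply: derivable_bigsum => p; apply: derivable_mulf.
  exact: derivable_cst.
by apply: derivable_bigprod => i.
Qed.

(** By Cramer's rule the entries of the inverse are polynomials in the entries of [F] divided by the
    determinant. *)
Lemma mx_derivable_inv n (F : R -> 'M[R]_n) s :
  (forall t, F t \in unitmx) -> mx_derivable F s ->
  mx_derivable (fun t => invmx (F t)) s.
Proof.
move=> Fu dF i j; under eq_fun do rewrite /invmx Fu mxE.
apply: derivable_mulf.
  apply: derivableV; last exact: derivable_det.
  by rewrite -unitfE -unitmxE.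
under eq_fun do rewrite mxE; apply: derivable_mulf; first exact: derivable_cst.
apply: derivable_det => k l.
by under eq_fun do rewrite !mxE; exact: dF.
Qed.

Definition mx_continuous m n (F : R -> 'M[R]_(m, n)) s :=
  forall i j, F t i j @[t --> s] --> F s i j.

Lemma mx_derivable_continuous m n (F : R -> 'M[R]_(m, n)) s :
  mx_derivable F s -> mx_continuous F s.
Proof.
by move=> dF i j; exact/differentiable_continuous/derivable1_diffP.
Qed.

Lemma mx_continuous_cst m n (B : 'M[R]_(m, n)) s : mx_continuous (fun=> B) s.
Proof. by move=> i j; exact: cvg_cst. Qed.

Lemma mx_continuousB m n (F G : R -> 'M[R]_(m, n)) s :
  mx_continuous F s -> mx_continuous G s ->
  mx_continuous (fun t => F t - G t) s.
Proof.
move=> cF cG i j; under eq_fun do rewrite mxE [X in _ + X]mxE.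
by rewrite mxE [X in _ + X]mxE; exact: cvgB.
Qed.

Lemma mx_continuousM m n p (F : R -> 'M[R]_(m, n)) (G : R -> 'M[R]_(n, p)) s :
  mx_continuous F s -> mx_continuous G s ->
  mx_continuous (fun t => F t *m G t) s.
Proof.
move=> cF cG i j; under eq_fun do rewrite mxE.
by rewrite mxE; apply: cvg_bigsum => k; exact: cvgM.
Qed.

Lemma mx_continuousZ m n (c : R -> R) (F : R -> 'M[R]_(m, n)) s :
  c t @[t --> s] --> c s -> mx_continuous F s ->
  mx_continuous (fun t => c t *: F t) s.
Proof.
by move=> cc cF i j; under eq_fun do rewrite mxE; rewrite mxE; exact: cvgM.
Qed.

(** Carathéodory's form of the derivative: [G] is a difference quotient continuous at [s], which can
    be substituted into matrix identities without dividing by [t - s]. *)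
Lemma mx_caratheodory m n (F : R -> 'M[R]_(m, n)) (dF : 'M[R]_(m, n)) s :
  (forall i j, is_derive s 1 (fun t => F t i j) (dF i j)) ->
  exists G : R -> 'M[R]_(m, n),
    [/\ forall t, F t - F s = (t - s) *: G t, mx_continuous G s & G s = dF].
Proof.
move=> FdF.
have /choice[G GP] : forall p : 'I_m * 'I_n, exists g : R -> R,
    [/\ forall z, F z p.1 p.2 - F s p.1 p.2 = g z * (z - s),
     {for s, continuous g} & g s = dF p.1 p.2].
  by move=> p; apply/is_derive1_caratheodory; exact: FdF.
exists (fun t => \matrix_(i, j) G (i, j) t); split.
- move=> t; apply/matrixP => i j; have [/(_ t)/= E _ _] := GP (i, j).
  by rewrite !mxE E mulrC.
- move=> i j; under eq_fun do rewrite mxE.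
  by rewrite mxE; have [_ + _] := GP (i, j).
- by apply/matrixP => i j; rewrite mxE; have [_ _ ->] := GP (i, j).
Qed.

(** Meant for [f] known only through a linear equation for its increments, whose coefficient [d] may
    vanish away from [s]. *)
Lemma is_derive_quotient f (d N : R -> R) s :
  (forall t, (f t - f s) * d t = N t * (t - s)) ->
  d t @[t --> s] --> d s -> d s != 0 -> N t @[t --> s] --> N s ->
  is_derive s 1 f (N s / d s).
Proof.
move=> fdN dc dN0 Nc; apply/is_derive1_caratheodory.
(* Where [d t = 0] the ordinary difference quotient keeps the factorization valid; near [s] only
   [N t / d t] occurs. *)
exists (fun t => if d t == 0 then (f t - f s) / (t - s) else N t / d t).
split; last by rewrite (negbTE dN0).
- move=> t; have [dt0|dtN0] := eqVneq (d t) 0.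
    rewrite divfK// subr_eq0; apply: contraNneq dN0 => <-; exact/eqP.
  by apply: (mulIf dtN0); rewrite fdN mulrAC divfK.
- rewrite /prop_for /continuous_at (negbTE dN0).
  have : N t / d t @[t --> s] --> N s / d s by apply: cvgM => //; exact: cvgV.
  apply: cvg_trans; apply: near_eq_cvg.
  have : \forall t \near s, d t != 0 by exact: cvgr_neq0 dc dN0.
  by apply: filterS => t /negbTE ->.
Qed.

End EntrywiseCalculus.

(** * Differentiability of the Perron-Frobenius pair *)

Section PerronFamily.
Variables (R : realType) (n : nat) (i0 : 'I_n).
Variables (A : R -> 'M[R]_n) (la : R -> R) (v : R -> 'rV[R]_n).
Hypothesis A_ge0 : forall s, nonneg_mx (A s).
Hypothesis A_irr : forall s, irreducible_mx (A s).
Hypothesis v_gt0 : forall s i, 0 < v s 0 i.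
Hypothesis v_sum : forall s, \sum_i v s 0 i = 1.
Hypothesis v_eigen : forall s, v s *m A s = la s *: v s.

Let ones : 'cV[R]_n := const_mx 1.

Let mulmx_ones (w : 'rV[R]_n) : w *m ones = (\sum_i w 0 i)%:M.
Proof.
apply/matrixP => i j; rewrite !ord1 !mxE eqxx mulr1n.
by apply: eq_bigr => k _; rewrite mxE mulr1.
Qed.

(* A rank-one perturbation of [A s - la s]: on differences [v t - v s], whose
   entries sum to 0, it acts as [A s - la s], but it is invertible. *)
Definition bordered_mx s : 'M[R]_n := A s - (la s)%:M - ones *m v s.

Lemma mulmx_bordered s (w : 'rV[R]_n) :
  w *m bordered_mx s = w *m A s - la s *: w - (\sum_i w 0 i) *: v s.
Proof.
by rewrite /bordered_mx !mulmxBr mul_mx_scalar mulmxA mulmx_ones mul_scalar_mx.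
Qed.

(** A vector [w] in the kernel satisfies [w A = la w + mu v] with [mu] its total mass. Simplicity
    gives [mu = 0], uniqueness makes [w] a multiple of [v s], and mass 0 makes it zero. *)
Lemma bordered_unit s : bordered_mx s \in unitmx.
Proof.
rewrite -row_free_unit; apply: inj_row_free => w; rewrite mulmx_bordered.
move=> /eqP; rewrite subr_eq0 subr_eq addrC => /eqP wA.
have sw0 := pf_eigen_simple i0 (A_ge0 s) (v_gt0 s) (v_eigen s) wA.
move: wA; rewrite sw0 scale0r addr0 => wA.
have [c wcv] := pf_eigen_unique (A_ge0 s) (A_irr s) (v_gt0 s) (v_eigen s) wA.
move: sw0; rewrite wcv; under eq_bigr do rewrite mxE.
by rewrite -mulr_sumr v_sum mulr1 => ->; rewrite scale0r.
Qed.

(** An exact increment formula, from which continuity and both derivatives are read off. It comes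
    from applying [A s - la s] to [v t] and using the eigenvector equation at [t]. *)
Lemma pf_vector_sub s t : v t - v s =
  ((la t - la s) *: v t - v t *m (A t - A s)) *m invmx (bordered_mx s).
Proof.
apply: (canRL (mulmxK (bordered_unit s))).
rewrite mulmx_bordered (_ : \sum_i _ = 0) ?scale0r ?subr0.
  by rewrite mulmxBl mulmxBr !v_eigen; apply/rowP => j; rewrite !mxE; ring.
under eq_bigr do rewrite mxE [X in _ + X]mxE.
by rewrite sumrB !v_sum subrr.
Qed.

Lemma pf_vector_inv_bordered s : v s *m invmx (bordered_mx s) = - v s.
Proof.
apply: (canLR (mulmxK (bordered_unit s))).
by rewrite mulNmx mulmx_bordered v_eigen subrr sub0r v_sum scale1r opprK.
Qed.

Lemma pf_vector_le1 s i : v s 0 i <= 1.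
Proof.
by rewrite -(v_sum s) (bigD1 i)//= lerDl; apply: sumr_ge0 => j _; exact: ltW.
Qed.

(** For [t] near [s], [v s] is an eigenvector of [A t] up to relative error [e] in each coordinate,
    so [subinvariant_le] traps [la t] without any continuity of [v]. *)
Lemma pf_value_continuous s : mx_continuous A s -> la t @[t --> s] --> la s.
Proof.
move=> Ac; apply/cvgrPdist_le => e e0.
have small : \forall t \near s, forall j : 'I_n,
    `|(v s *m (A t - A s)) 0 j| <= e * v s 0 j.
  suff smallj j : \forall t \near s, `|(v s *m (A t - A s)) 0 j| <= e * v s 0 j.
    exact: filter_forall smallj.
  have : mx_continuous (fun t => v s *m (A t - A s)) s.
    apply: mx_continuousM; first exact: mx_continuous_cst.
    by apply: mx_continuousB => //; exact: mx_continuous_cst.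
  move=> /(_ 0 j); rewrite subrr mulmx0 mxE => /cvgrPdist_le.
  move=> /(_ (e * v s 0 j)) /(_ (mulr_gt0 e0 (v_gt0 s j))).
  by apply: filterS => t; rewrite sub0r normrN.
have vN0 t : v t != 0 by apply/rV0Pn; exists i0; rewrite gt_eqF.
move: small; apply: filterS => t small.
have vA j : (v s *m A t) 0 j = la s * v s 0 j + (v s *m (A t - A s)) 0 j.
  have -> : v s *m A t = v s *m A s + v s *m (A t - A s).
    by rewrite mulmxBr addrC subrK.
  by rewrite mxE v_eigen [X in X + _]mxE.
rewrite distrC ler_distl; apply/andP; split.
- apply: (@subinvariant_le _ _ (A t) (v t) (v s)) => //.
  + by move=> j; rewrite v_eigen mxE.
  + by move=> j; rewrite ltW.
  + move=> j; rewrite vA mulrBl lerD2l.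
    by have := small j; rewrite ler_norml => /andP[].
- apply: (@subinvariant_le _ _ (A t) (v s) (v t)) => //.
  + move=> j; rewrite vA mulrDl lerD2l.
    by have := small j; rewrite ler_norml => /andP[].
  + by move=> j; rewrite ltW.
  + by move=> j; rewrite v_eigen mxE.
Qed.

(** In [pf_vector_sub] the vector [v t] occurs only multiplied by factors tending to 0, so the bound
    of its entries by 1 suffices. *)
Lemma pf_vector_continuous s : mx_continuous A s -> mx_continuous v s.
Proof.
move=> Ac.
pose D t := (la t - la s) *: v t - v t *m (A t - A s).
have D0 : D s = 0 by rewrite /D !subrr scale0r mulmx0 subrr.
have bounded0 (x : R -> R) k : x t @[t --> s] --> 0 ->
    v t 0 k * x t @[t --> s] --> 0.
  move=> x0; apply/norm_cvg0P.
  apply: (@squeeze_cvgr _ _ _ _ (cst 0) (fun t => `|x t|)).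
  - apply: nearW => t /=; rewrite normr_ge0/= normrM ler_piMl//.
    by rewrite ger0_norm ?pf_vector_le1// ltW.
  - exact: cvg_cst.
  - exact/norm_cvg0P.
have Dc : mx_continuous D s.
  move=> i k; rewrite ord1 {i} D0 mxE.
  under eq_fun do rewrite mxE [X in X + _]mxE [X in _ + X]mxE [X in _ - X]mxE.
  have value_part : (la t - la s) * v t 0 k @[t --> s] --> 0.
    under eq_fun do rewrite mulrC.
    apply: bounded0; rewrite -(subrr (la s)); apply: cvgB; last exact: cvg_cst.
    exact: pf_value_continuous.
  have mx_part i : v t 0 i * (A t - A s) i k @[t --> s] --> 0.
    apply: bounded0; under eq_fun do rewrite mxE [X in _ + X]mxE.
    by rewrite -(subrr (A s i k)); apply: cvgB; [exact: Ac|exact: cvg_cst].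
  have := cvgB value_part (cvg_bigsum (r := index_enum 'I_n) _ mx_part).
  by rewrite big1// subr0 => H; exact: (H _ _).
have -> : v = (fun t => D t *m invmx (bordered_mx s) - (- v s)).
  by apply/funext => t; rewrite opprK -pf_vector_sub subrK.
apply: mx_continuousB; last exact: mx_continuous_cst.
by apply: mx_continuousM; last exact: mx_continuous_cst.
Qed.

Section Derivative.
Variable dA : R -> 'M[R]_n.
Hypothesis A_derive : forall (s : R) i j,
  is_derive s 1 (fun t => A t i j) (dA s i j).

Let A_continuous s : mx_continuous A s.
Proof.
by apply: mx_derivable_continuous => i j; have [] := A_derive s i j.
Qed.

(** Summing the coordinates in [pf_vector_sub] makes the left side 0; to first order this is a
    linear equation for the derivative of [la], with coefficient -1 by [pf_vector_inv_bordered]. *)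
Definition pf_value_deriv s : R :=
  - \sum_j (v s *m dA s *m invmx (bordered_mx s)) 0 j.

Definition pf_vector_deriv s : 'rV[R]_n :=
  (pf_value_deriv s *: v s - v s *m dA s) *m invmx (bordered_mx s).

Lemma is_derive_pf_value (s : R) : is_derive s 1 la (pf_value_deriv s).
Proof.
have [G [AG Gc Gs]] := mx_caratheodory (A_derive s).
pose Mi := invmx (bordered_mx s).
pose d t := \sum_j (v t *m Mi) 0 j.
pose N t := \sum_j (v t *m G t *m Mi) 0 j.
have ds : d s = -1.
  rewrite /d pf_vector_inv_bordered; under eq_bigr do rewrite mxE.
  by rewrite sumrN v_sum.
have -> : pf_value_deriv s = N s / d s.
  by rewrite ds /N Gs invrN invr1 mulrN1.
have vc : mx_continuous v s := pf_vector_continuous (@A_continuous s).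
apply: is_derive_quotient.
- move=> t; have := pf_vector_sub s t; rewrite -/Mi => vsub.
  have : \sum_j (v t - v s) 0 j = 0.
    under eq_bigr do rewrite mxE [X in _ + X]mxE.
    by rewrite sumrB !v_sum subrr.
  rewrite vsub mulmxBl -!scalemxAl AG -scalemxAr -scalemxAl.
  under eq_bigr do rewrite mxE [X in X + _]mxE [X in _ + X]mxE [X in _ - X]mxE.
  rewrite sumrB -!mulr_sumr -/(d t) -/(N t) => /eqP.
  by rewrite subr_eq0 => /eqP ->; rewrite mulrC.
- apply: cvg_bigsum => j; apply: mx_continuousM => //.
  exact: mx_continuous_cst.
- by rewrite ds oppr_eq0 oner_eq0.
- apply: cvg_bigsum => j; apply: mx_continuousM; last exact: mx_continuous_cst.
  exact: mx_continuousM.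
Qed.

Lemma is_derive_pf_vector (s : R) j :
  is_derive s 1 (fun t => v t 0 j) (pf_vector_deriv s 0 j).
Proof.
have [G [AG Gc Gs]] := mx_caratheodory (A_derive s).
have /is_derive1_caratheodory[g [lag gc gs]] := is_derive_pf_value s.
have vc : mx_continuous v s := pf_vector_continuous (@A_continuous s).
pose H t := (g t *: v t - v t *m G t) *m invmx (bordered_mx s).
have Hs : H s = pf_vector_deriv s by rewrite /H gs Gs.
apply/is_derive1_caratheodory; exists (fun t => H t 0 j); split.
- move=> t; have -> : v t 0 j - v s 0 j = (v t - v s) 0 j by rewrite !mxE.
  rewrite pf_vector_sub AG lag -scalemxAr [g t * _]mulrC -scalerA -scalerBr.
  by rewrite -scalemxAl mxE mulrC.
- apply: mx_continuousM; last exact: mx_continuous_cst.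
  apply: mx_continuousB; last exact: mx_continuousM.
  exact: mx_continuousZ.
- by rewrite Hs.
Qed.

Hypothesis dA_derivable : forall s, mx_derivable dA s.

Let v_derivable s : mx_derivable v s.
Proof. by move=> i j; rewrite ord1; have [] := is_derive_pf_vector s j. Qed.

Let inv_bordered_derivable s : mx_derivable (fun t => invmx (bordered_mx t)) s.
Proof.
apply: mx_derivable_inv; first exact: bordered_unit.
apply: mx_derivableB; first apply: mx_derivableB.
- by move=> i j; have [] := A_derive s i j.
- by apply: mx_derivable_scalar; have [] := is_derive_pf_value s.
- by apply: mx_derivableM => //; exact: mx_derivable_cst.
Qed.

Lemma derivable_pf_value_deriv (s : R) : derivable pf_value_deriv s 1.
Proof.
apply: derivableN; apply: derivable_bigsum => j.
by apply: mx_derivableM => //; exact: mx_derivableM.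
Qed.

Lemma derivable_pf_vector_deriv (s : R) j :
  derivable (fun t => pf_vector_deriv t 0 j) s 1.
Proof.
apply: mx_derivableM => //; apply: mx_derivableB; last exact: mx_derivableM.
by apply: mx_derivableZ => //; exact: derivable_pf_value_deriv.
Qed.

End Derivative.

End PerronFamily.

(** * The exponential family *)

Lemma mxX_ge_scaled (R : realType) n (A B : 'M[R]_n) (c : R) k :
  0 <= c -> nonneg_mx B -> (forall i j, c * B i j <= A i j) ->
  forall i j, c ^+ k * (B ^+ k) i j <= (A ^+ k) i j.
Proof.
move=> c0 B0 BA; elim: k => [|k IHk] i j; first by rewrite !expr0 mul1r.
rewrite !exprS !mxE mulr_sumr; apply: ler_sum => l _.
rewrite mulrACA ler_pM ?mulr_ge0 ?exprn_ge0//; exact: nonneg_mxX.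
Qed.

Section ExponentialFamily.
Variables (R : realType) (X : finType) (W g : X -> X -> R) (x0 : X).
Hypothesis W_transition : transition_matrix W.
Hypothesis W_irr : irreducible_kernel W.

Let W_ge0 x x' : 0 <= W x x'. Proof. by have [] := W_transition x'. Qed.

Let A s : 'M[R]_#|X| := mx_of_kernel (tilted_kernel W g s).

Let A_ge0 s : nonneg_mx (A s).
Proof. by move=> i j; rewrite mxE mulr_ge0// expR_ge0. Qed.

Let A_irr s : irreducible_mx (A s).
Proof.
move=> i j; have [k Wk] := W_irr (enum_val i) (enum_val j).
exists k; move: Wk; rewrite /kernel_pow !enum_valK => Wk.
(* A common lower bound for all factors [expR (s * g x x')], since the double sum dominates every
   value of [|g|]. *)
pose c := expR (- (`|s| * \sum_x \sum_x' `|g x x'|)).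
have cW i' j' : c * mx_of_kernel W i' j' <= A s i' j'.
  rewrite !mxE mulrC ler_wpM2l// ler_expR lerNl -mulrN.
  apply: le_trans (ler_norm _) _; rewrite normrM normrN ler_wpM2l//.
  rewrite (bigD1 (enum_val i'))//= (bigD1 (enum_val j'))//= -addrA lerDl.
  by rewrite addr_ge0//; apply: sumr_ge0 => // x _; exact: sumr_ge0.
apply: lt_le_trans (mxX_ge_scaled k _ _ cW i j).
- by rewrite mulr_gt0// exprn_gt0// expR_gt0.
- exact: expR_ge0.
- by move=> i' j'; rewrite mxE.
Qed.

(* [q s] is the Perron-Frobenius eigenvector of mass 1; [pf_P3 W g s] is an
   arbitrary multiple of it, which may depend badly on [s]. *)
Lemma exp_family_normalized : exists (q dq : R -> X -> R) (dla : R -> R),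
  [/\ forall s x, 0 < q s x,
      forall s x', \sum_x q s x * tilted_kernel W g s x x' =
                   pf_lambda W g s * q s x',
      forall s x x', exp_family W g s x x' =
        (pf_lambda W g s)^-1 * q s x * tilted_kernel W g s x x' * (q s x')^-1,
      (forall (s : R) x, is_derive s 1 (q ^~ x) (dq s x)) /\
      (forall (s : R) x, derivable (dq ^~ x) s 1) &
      (forall s : R, is_derive s 1 (pf_lambda W g) (dla s)) /\
      (forall s : R, derivable dla s 1)].
Proof.
pose i0 := enum_rank x0.
have /choice[rv rvP] : forall s, exists rv : R * 'rV[R]_#|X|,
    [/\ forall i, 0 < rv.2 0 i, \sum_i rv.2 0 i = 1 &
        rv.2 *m A s = rv.1 *: rv.2].
  move=> s; have [r [v vP]] := perron_frobenius i0 (@A_ge0 s) (@A_irr s).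
  by exists (r, v).
pose v s := (rv s).2.
have v0 s i : 0 < v s 0 i by have [] := rvP s.
have v1 s : \sum_i v s 0 i = 1 by have [] := rvP s.
have laE s : pf_lambda W g s = (rv s).1.
  by have [r0 _ rA] := rvP s; exact: (pf_eigenvalueE i0 (@A_ge0 s) r0 rA).
have vA s : v s *m A s = pf_lambda W g s *: v s.
  by rewrite laE; have [] := rvP s.
pose dA s : 'M[R]_#|X| :=
  mx_of_kernel (fun x x' => g x x' * tilted_kernel W g s x x').
have AdA (s : R) i j : is_derive s 1 (fun t => A t i j) (dA s i j).
  under eq_fun do rewrite mxE /tilted_kernel.
  rewrite mxE /tilted_kernel.
  set y := enum_val i; set y' := enum_val j.
  have E : is_derive s 1 (expR \o (fun t : R => t * g y y'))
      (expR (s * g y y') * g y y').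
    by apply: is_derive1_comp; exact: is_derive_linear.
  by rewrite mulrC -mulrA; exact: (is_derive_scalef (W y y') E).
have ddA s : mx_derivable dA s.
  move=> i j; have [dAs _] := AdA s i j.
  have -> : (fun t => dA t i j) =
      (fun t => g (enum_val i) (enum_val j) * A t i j).
    by apply/funext => t; rewrite !mxE.
  by apply: derivable_mulf; [exact: derivable_cst|exact: dAs].
have sumE (F : X -> R) : \sum_x F x = \sum_(i < #|X|) F (enum_val i).
  rewrite (reindex (fun i : 'I_#|X| => enum_val i))//.
  exact/onW_bij/enum_val_bij.
exists (fun s x => v s 0 (enum_rank x)).
exists (fun s x => pf_vector_deriv A (pf_lambda W g) v dA s 0 (enum_rank x)).
exists (pf_value_deriv A (pf_lambda W g) v dA); split.
- by move=> s x; exact: v0.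
- move=> s x'; have /rowP/(_ (enum_rank x')) := vA s; rewrite !mxE => <-.
  by rewrite sumE; apply: eq_bigr => i _; rewrite mxE enum_valK enum_rankK.
- move=> s x x'.
  (* The transpose of [v s] shows that the set is inhabited, so [pf_eigenvector] is not the default
     0; uniqueness then gives the factor [c], which cancels in [exp_family]. *)
  have [u0 uA] : [set u : 'cV[R]_#|X| | (forall i, 0 < u i 0) /\
      (A s)^T *m u = pf_eigenvalue (A s)^T *: u] (pf_eigenvector (A s)^T).
    apply: xgetPex; exists (v s)^T; split; first by move=> i; rewrite mxE.
    by rewrite -trmx_mul vA linearZ/= pf_eigenvalue_tr.
  set u := pf_eigenvector (A s)^T in u0 uA.
  have uTA : u^T *m A s = pf_lambda W g s *: u^T.
    by rewrite -[A s]trmxK -trmx_mul uA linearZ/= pf_eigenvalue_tr.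
  have [c uc] := pf_eigen_unique (@A_ge0 s) (@A_irr s) (v0 s) (vA s) uTA.
  have P3E y : pf_P3 W g s y = c * v s 0 (enum_rank y).
    by have /rowP/(_ (enum_rank y)) := uc; rewrite !mxE.
  have cN0 : c != 0.
    have : 0 < pf_P3 W g s x0 := u0 i0.
    by apply: contraTneq => c0; rewrite P3E c0 mul0r ltxx.
  rewrite /exp_family !P3E invfM.
  have vN0 : v s 0 (enum_rank x') != 0 by rewrite gt_eqF.
  (* Positivity of [pf_lambda] is deduced later from this lemma; at the value 0 both sides
     vanish. *)
  have [->|lN0] := eqVneq (pf_lambda W g s) 0; first by rewrite invr0 !mul0r.
  by field; rewrite cN0 vN0 lN0.
- split=> s x; first exact: is_derive_pf_vector.
  exact: derivable_pf_vector_deriv.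
- split=> s; first exact: is_derive_pf_value.
  exact: derivable_pf_value_deriv.
Qed.

Lemma pf_lambda_gt0 s : 0 < pf_lambda W g s.
Proof.
have [q [dq [dla [q0 qA _ _ _]]]] := exp_family_normalized.
have [_ W1] := W_transition x0.
have [x Wx] : exists x, 0 < W x x0.
  apply/existsP; apply: contraT; rewrite negb_exists => /forallP W0.
  move: W1; rewrite big1 => [/eqP|x _]; first by rewrite eq_sym oner_eq0.
  by apply/eqP; rewrite eq_le W_ge0 leNgt W0.
rewrite -(pmulr_lgt0 _ (q0 s x0)) -qA (bigD1 x)//= ltr_wpDr//.
  by apply: sumr_ge0 => y _; rewrite !mulr_ge0 ?expR_ge0// ltW.
by rewrite !mulr_gt0 ?expR_gt0.
Qed.

End ExponentialFamily.

(** * The score and its Poisson equation *)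

Section Score.
Variables (R : realType) (X : finType) (W g : X -> X -> R) (x0 : X).
Hypothesis W_transition : transition_matrix W.
Hypothesis W_irr : irreducible_kernel W.

Definition score (a : R -> X -> R) (s : R) (x x' : X) : R :=
  g x x' - expectation_param W g s + a s x - a s x'.

(* [a] is the logarithmic derivative of the normalized eigenvector. *)
Lemma exp_family_score : exists a : R -> X -> R,
  [/\ forall (s : R) x, derivable (a ^~ x) s 1,
      forall s : R, derivable (expectation_param W g) s 1,
      forall (s : R) x x', is_derive s 1 (fun t => exp_family W g t x x')
        (exp_family W g s x x' * score a s x x'),
      forall s x', \sum_x exp_family W g s x x' = 1 &
      forall s x x', 0 <= exp_family W g s x x' /\
        (0 < W x x' -> 0 < exp_family W g s x x')].
Proof.
have [q [dq [dla [q0 qA VE [qdq ddq] [ladla ddla]]]]] :=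
  exp_family_normalized g x0 W_transition W_irr.
have la0 s : 0 < pf_lambda W g s := pf_lambda_gt0 g x0 W_transition W_irr s.
have etaE : expectation_param W g = (fun s => dla s / pf_lambda W g s).
  apply/funext => s; rewrite /expectation_param derive1E.
  have lns : is_derive (pf_lambda W g s) 1 (@ln R) (pf_lambda W g s)^-1.
    exact: is_derive1_ln.
  have [_ ->] := is_derive1_comp lns (ladla s).
  by rewrite mulrC.
have W0 x x' : 0 <= W x x' by have [] := W_transition x'.
have T0 s x x' : 0 <= tilted_kernel W g s x x' by rewrite mulr_ge0 ?expR_ge0.
have qN0 s x : q s x != 0 by rewrite gt_eqF.
have laN0 s : pf_lambda W g s != 0 by rewrite gt_eqF.
exists (fun s x => dq s x / q s x); split.
- move=> s x; apply: derivable_mulf; first exact: ddq.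
  by apply: derivableV => //; have [] := qdq s x.
- move=> s; rewrite etaE; apply: derivable_mulf; first exact: ddla.
  by apply: derivableV => //; have [] := ladla s.
- move=> s x x'; rewrite /score etaE.
  under eq_fun do rewrite VE.
  have E : is_derive s 1 (expR \o (fun t : R => t * g x x'))
      (expR (s * g x x') * g x x').
    by apply: is_derive1_comp; exact: is_derive_linear.
  have VdV := (is_derive_mulf (is_derive_mulf (is_derive_mulf
      (is_derive_invf (laN0 s) (ladla s)) (qdq s x))
      (is_derive_scalef (W x x') E)) (is_derive_invf (qN0 s x') (qdq s x'))).
  apply: is_derive_eq.
  rewrite VE /tilted_kernel /=; field.
  by rewrite laN0 !qN0.
- move=> s x'.
  have -> : \sum_x exp_family W g s x x' = (pf_lambda W g s)^-1 *
      (\sum_x q s x * tilted_kernel W g s x x') / q s x'.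
    rewrite mulr_sumr mulr_suml; apply: eq_bigr => x _.
    by rewrite VE; congr (_ / _); rewrite -mulrA.
  by rewrite qA mulKf// mulfV.
- move=> s x x'; rewrite VE; split.
    by rewrite !mulr_ge0 ?invr_ge0// ltW.
  by move=> Wx; rewrite !mulr_gt0 ?invr_gt0 ?expR_gt0.
Qed.

Section Poisson.
Variable a : R -> X -> R.
Hypothesis a_derivable : forall (s : R) x, derivable (a ^~ x) s 1.
Hypothesis eta_derivable : forall s : R, derivable (expectation_param W g) s 1.
Hypothesis V_derive : forall (s : R) x x',
  is_derive s 1 (fun t => exp_family W g t x x')
    (exp_family W g s x x' * score a s x x').
Hypothesis V_sum : forall s x', \sum_x exp_family W g s x x' = 1.
Hypothesis V_ge0 : forall s x x', 0 <= exp_family W g s x x'.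
Hypothesis V_gt0 : forall s x x', 0 < W x x' -> 0 < exp_family W g s x x'.

Lemma score_mean0 s x' :
  \sum_x exp_family W g s x x' * score a s x x' = 0.
Proof.
apply: (is_derive_constant (fun t => V_sum t x')).
exact: (is_derive_bigsum _ (fun x => V_derive s x x')).
Qed.

(* Differentiating [score_mean0] gives a Poisson equation for the conditional
   second moment of the score, with solution the derivative of [a]. *)
Lemma score_poisson s x' :
  \sum_x exp_family W g s x x' *
    (score a s x x' ^+ 2 + derive1 (a ^~ x) s) =
  derive1 (expectation_param W g) s + derive1 (a ^~ x') s.
Proof.
set de := derive1 _ s; set b := fun x => derive1 (a ^~ x) s.
have scoreD x : is_derive s 1 (fun t => score a t x x') (- de + b x - b x').
  have Dc : is_derive s (1 : R) (fun t : R => g x x') 0 := is_derive_cst _ s 1.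
  have De : is_derive s 1 (expectation_param W g) de.
    by rewrite /de derive1E; exact: derivableP.
  have Da y : is_derive s 1 (a ^~ y) (b y).
    by rewrite /b derive1E; exact: derivableP.
  rewrite -[- de]add0r.
  exact: (is_derive_addf (is_derive_addf (is_derive_addf Dc (is_derive_oppf De))
    (Da x)) (is_derive_oppf (Da x'))).
have /(is_derive_constant (score_mean0 ^~ x')) := is_derive_bigsum
  (index_enum X) (fun x => is_derive_mulf (V_derive s x x') (scoreD x)).
move=> E0; apply/eqP; rewrite -subr_eq0; apply/eqP; apply: etrans E0.
rewrite -[de + b x']mul1r -(V_sum s x') mulr_suml -sumrB.
by apply: eq_bigr => x _; rewrite -/(b x); ring.
Qed.

(** At a minimizer of [b] every term of the Poisson sum is nonnegative. If the sum were 0, then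
    along each [W]-edge out of a minimizer [h] would vanish and the arrival state would again be a
    minimizer. Irreducibility spreads this to all edges, and [h = 0] there exhibits [g] as
    dependent. *)
Lemma expectation_param_deriv_gt0 s : linearly_independent_under W g ->
  0 < derive1 (expectation_param W g) s.
Proof.
move=> g_ind; set de := derive1 _ s; pose b x := derive1 (a ^~ x) s.
pose V := exp_family W g s; pose h := score a s.
have poisson x' : \sum_x V x x' * (h x x' ^+ 2 + (b x - b x')) = de.
  have := score_poisson s x'; rewrite -/de -/(b x') => E.
  rewrite -[RHS](addrK (b x')) -E -[X in _ = _ - X]mul1r -(V_sum s x').
  rewrite mulr_suml -sumrB; apply: eq_bigr => x _.
  by rewrite -/V -/h -/(b x); ring.
case: (@Order.TotalTheory.arg_minP _ _ _ x0 xpredT b) => // m _ bm.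
have term0 x x' : b x' = b m -> 0 <= V x x' * (h x x' ^+ 2 + (b x - b x')).
  move=> ->; rewrite mulr_ge0 ?V_ge0// addr_ge0 ?sqr_ge0// subr_ge0.
  exact: bm.
rewrite lt_def -(poisson m) sumr_ge0 ?andbT; last by move=> x _; exact: term0.
rewrite poisson; apply/eqP => de0.
have step x x' : b x' = b m -> 0 < W x x' -> h x x' = 0 /\ b x = b m.
  move=> bx' Wx; have := poisson x'; rewrite de0 => /eqP.
  rewrite psumr_eq0 => [/allP/(_ x (mem_index_enum x))|y _]; last exact: term0.
  rewrite /= mulf_eq0 gt_eqF ?V_gt0//= bx'.
  rewrite paddr_eq0 ?sqr_ge0 ?subr_ge0//; last exact: bm.
  by rewrite sqrf_eq0 [b x - _ == 0]subr_eq0 => /andP[/eqP ? /eqP].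
have bconst x : b x = b m.
  have [k] := W_irr x m; rewrite /kernel_pow.
  elim: k x => [|k IHk] x.
    rewrite expr0 mxE; have [/enum_rank_inj -> //|_] := eqVneq.
    by rewrite ltxx.
  rewrite exprS mxE => S0.
  have [j] : exists j, 0 < mx_of_kernel W (enum_rank x) j *
      (mx_of_kernel W ^+ k) j (enum_rank m).
    apply/existsP; apply: contraLR S0; rewrite negb_exists => /forallP S0.
    by rewrite -leNgt; apply: sumr_le0 => j _; rewrite leNgt S0.
  have W0 : nonneg_mx (mx_of_kernel W).
    by move=> i' j'; rewrite mxE; have [] := W_transition (enum_val j').
  rewrite lt_def mulf_eq0 negb_or => /andP[/andP[Wx Wk] _].
  apply: (proj2 (step x (enum_val j) _ _)).
    by apply: IHk; rewrite enum_valK lt_def Wk; exact: nonneg_mxX.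
  by move: Wx (W0 (enum_rank x) j); rewrite mxE enum_rankK lt_def => -> ->.
apply: g_ind; exists (fun x => - a s x), (expectation_param W g s) => x x' Wx.
have [+ _] := step x x' (bconst x') Wx; rewrite /h /score => E.
apply/eqP; rewrite -subr_eq0.
by rewrite -[X in _ == X]E; apply/eqP; ring.
Qed.

End Poisson.

End Score.

(** * Fisher information along Markov paths *)

Lemma sum_tuple_cons (R : nmodType) (X : finType) n (F : n.+1.-tuple X -> R) :
  \sum_w F w = \sum_x \sum_(w : n.-tuple X) F [tuple of x :: w].
Proof.
rewrite pair_big/= (reindex (fun p : X * n.-tuple X => [tuple of p.1 :: p.2])).
  by [].
exists (fun w => (thead w, [tuple of behead w])) => [[x w] _|w _] /=.
  by congr (_, _); exact: val_inj.
by rewrite -tuple_eta.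
Qed.

Section MarkovPaths.
Variables (R : realType) (X : finType) (V h : X -> X -> R).

Definition path_sum n (w : n.+1.-tuple X) : R :=
  \sum_(i < n) h (tnth w (lift ord0 i)) (tnth w (widen_ord (leqnSn n) i)).

Lemma markov_dist_cons n (p : X -> R) x (w : n.+1.-tuple X) :
  markov_dist V p [tuple of x :: w] = p x * markov_dist V (V ^~ x) w.
Proof.
rewrite /markov_dist tnth0 big_ord_recl; congr (_ * (_ * _)).
  by rewrite tnthS (_ : widen_ord _ _ = ord0) ?tnth0//; exact: val_inj.
apply: eq_bigr => i _; rewrite tnthS.
rewrite (_ : widen_ord _ _ = lift ord0 (widen_ord (leqnSn n) i)) ?tnthS//.
exact: val_inj.
Qed.

Lemma path_sum_cons n x (w : n.+1.-tuple X) :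
  path_sum [tuple of x :: w] = h (tnth w ord0) x + path_sum w.
Proof.
rewrite /path_sum big_ord_recl; congr (_ + _).
  by rewrite tnthS (_ : widen_ord _ _ = ord0) ?tnth0//; exact: val_inj.
apply: eq_bigr => i _; rewrite tnthS.
rewrite (_ : widen_ord _ _ = lift ord0 (widen_ord (leqnSn n) i)) ?tnthS//.
exact: val_inj.
Qed.

Lemma tnth_cons_max n x (w : n.+1.-tuple X) :
  tnth [tuple of x :: w] ord_max = tnth w ord_max.
Proof.
by rewrite (_ : ord_max = lift ord0 ord_max) ?tnthS//; exact: val_inj.
Qed.

(* The increments [h] are martingale differences, and the Poisson equation
   makes the sum of their conditional variances telescope. *)
Lemma path_second_moment (b : X -> R) (d : R) n (p c : X -> R) :
  (forall x', \sum_x V x x' = 1) -> (forall x', \sum_x V x x' * h x x' = 0) ->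
  (forall x', \sum_x V x x' * (h x x' ^+ 2 + b x) = d + b x') ->
  \sum_(w : n.+1.-tuple X) markov_dist V p w *
    ((c (tnth w ord0) + path_sum w) ^+ 2 + b (tnth w ord_max)) =
  \sum_x p x * (c x ^+ 2 + b x + n%:R * d).
Proof.
(* The induction removes the first state, hence the quantification over [p] and [c]: the remaining
   path starts from the law [V ^~ x], with the first increment added to the offset. *)
move=> V1 Vh Vhb; elim: n => [|n IHn] in p c *; rewrite sum_tuple_cons.
  apply: eq_bigr => x _; rewrite (big_pred1 [tuple]) => [|w]; last first.
    by rewrite /= tuple0.
  rewrite /markov_dist /path_sum !big_ord0 tnth0 (_ : ord_max = ord0) ?tnth0.
    by rewrite mulr1 addr0 mul0r addr0.
  exact: val_inj.
apply: eq_bigr => x _.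
under eq_bigr do
  rewrite markov_dist_cons path_sum_cons tnth_cons_max tnth0 addrA -mulrA.
rewrite -mulr_sumr; congr (_ * _).
rewrite (IHn (V ^~ x) (fun y => c x + h y x)).
transitivity (c x ^+ 2 * (\sum_y V y x) + 2 * c x * (\sum_y V y x * h y x) +
    \sum_y V y x * (h y x ^+ 2 + b y) + n%:R * d * (\sum_y V y x)).
  by rewrite !mulr_sumr -!big_split; apply: eq_bigr => y _ /=; ring.
by rewrite V1 Vh Vhb -natr1; ring.
Qed.

End MarkovPaths.

Lemma markov_dist_ge0 (R : realType) (X : finType) n (V : X -> X -> R)
    (p : X -> R) (w : n.+1.-tuple X) :
  (forall x x', 0 <= V x x') -> (forall x, 0 <= p x) -> 0 <= markov_dist V p w.
Proof. by move=> V0 p0; rewrite mulr_ge0// prodr_ge0. Qed.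

Lemma markov_dist_sum (R : realType) (X : finType) n (V : X -> X -> R)
    (p : X -> R) : (forall x', \sum_x V x x' = 1) ->
  \sum_(w : n.+1.-tuple X) markov_dist V p w = \sum_x p x.
Proof.
move=> V1.
(* With zero increments, zero offset and [b = 1], the second-moment formula computes the total
   mass. *)
have := @path_second_moment _ _ V (fun _ _ => 0) (fun=> 1) 0 n p (fun=> 0) V1.
have sum0 (w : n.+1.-tuple X) : path_sum (fun _ _ => 0 : R) w = 0.
  by rewrite /path_sum big1.
under eq_bigr do rewrite sum0 addr0 expr0n/= add0r mulr1.
move=> ->.
- by apply: eq_bigr => x _; rewrite expr0n/= mulr0 addr0 add0r mulr1.
- by move=> x'; rewrite big1// => x _; rewrite mulr0.
- move=> x'; rewrite add0r -[RHS](V1 x'); apply: eq_bigr => x _.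
  by rewrite expr0n/= add0r mulr1.
Qed.

(** The derivatives have the form [f i s * l i], without logarithms, so that factors may vanish. *)
Lemma is_derive_log_prod (R : realType) (I : Type) (r : seq I)
    (f : I -> R -> R) (l : I -> R) (s : R) :
  (forall i, is_derive s 1 (f i) (f i s * l i)) ->
  is_derive s 1 (fun t => \prod_(i <- r) f i t)
    (\prod_(i <- r) f i s * \sum_(i <- r) l i).
Proof.
move=> fl; elim: r => [|i r IHr].
  under eq_fun do rewrite big_nil.
  by rewrite !big_nil mulr0; exact: is_derive_cst.
under eq_fun do rewrite big_cons.
have := is_derive_mulf (fl i) IHr; rewrite !big_cons.
by congr (is_derive _ _ _ _); ring.
Qed.

Lemma is_derive_markov_dist (R : realType) (X : finType) n
    (V : R -> X -> X -> R) (P : R -> X -> R) (h : X -> X -> R) (D : X -> R)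
    (s : R) (w : n.+1.-tuple X) :
  (forall x x', is_derive s 1 (fun t => V t x x') (V s x x' * h x x')) ->
  is_derive s 1 (P ^~ (tnth w ord0)) (P s (tnth w ord0) * D (tnth w ord0)) ->
  is_derive s 1 (fun t => markov_dist (V t) (P t) w)
    (markov_dist (V s) (P s) w * (D (tnth w ord0) + path_sum h w)).
Proof.
move=> VD PD; rewrite /markov_dist.
have := is_derive_mulf PD (is_derive_log_prod (index_enum 'I_n) (fun i =>
  VD (tnth w (lift ord0 i)) (tnth w (widen_ord (leqnSn n) i)))).
by congr (is_derive _ _ _ _); rewrite -/(path_sum h w); ring.
Qed.

(** * Fisher information: score formula, reparametrization, linear growth *)

(** [S] has to be the logarithmic derivative only on the support: points of mass 0 contribute
    nothing to either side. *)
Lemma fisher_information_score (R : realType) (T : finType) (q : R -> T -> R)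
    (t : R) (S : T -> R) : (forall w, 0 <= q t w) ->
  (forall w, 0 < q t w -> is_derive t 1 (fun s => q s w) (q t w * S w)) ->
  fisher_information q t = \sum_w q t w * S w ^+ 2.
Proof.
move=> q0 qS; rewrite /fisher_information [RHS](bigID (fun w => 0 < q t w))/=.
rewrite [X in _ = _ + X]big1 ?addr0 => [|w]; last first.
  by rewrite lt_neqAle q0 andbT negbK => /eqP <-; rewrite mul0r.
apply: eq_bigr => w qw; congr (_ * _ ^+ 2).
have lnq : is_derive (q t w) 1 (@ln R) (q t w)^-1 by exact: is_derive1_ln.
have [_ E] := is_derive1_comp lnq (qS w qw).
by rewrite derive1E [LHS]E mulKf// gt_eqF.
Qed.

Lemma fisher_information_comp (R : realType) (T : finType) (q : R -> T -> R)
    (tau : R -> R) (e dtau : R) :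
  (forall w, 0 < q (tau e) w -> derivable (fun s => q s w) (tau e) 1) ->
  is_derive e 1 tau dtau ->
  fisher_information (fun s => q (tau s)) e =
  dtau ^+ 2 * fisher_information q (tau e).
Proof.
move=> dq dt; rewrite /fisher_information mulr_sumr; apply: eq_bigr => w qw.
have lnq : is_derive (q (tau e) w) 1 (@ln R) (q (tau e) w)^-1.
  exact: is_derive1_ln.
have lnqD := is_derive1_comp lnq (derivableP (dq w qw)).
have E : 'D_1 (fun s => ln (q (tau s) w)) e =
    (q (tau e) w)^-1 * 'D_1 (q ^~ w) (tau e) * dtau.
  by have [_] := is_derive1_comp lnqD dt.
have E' : 'D_1 (fun s => ln (q s w)) (tau e) =
    (q (tau e) w)^-1 * 'D_1 (q ^~ w) (tau e) by have [_] := lnqD.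
by rewrite !derive1E E E'; ring.
Qed.

Lemma cvg_affine_over_n (R : realType) (u : nat -> R) (d C : R) :
  (forall n, `|u n - n%:R * d| <= C) -> (fun n => u n / n%:R) @ \oo --> d.
Proof.
move=> uC; apply/cvgrPdist_le => e e0; near=> n.
have n0 : 0 < n%:R :> R by rewrite ltr0n; near: n; exact: nbhs_infty_gt.
rewrite distrC (_ : u n / n%:R - d = (u n - n%:R * d) / n%:R); last first.
  by rewrite mulrBl mulrAC divff ?gt_eqF// mul1r.
rewrite normrM normfV normr_nat ler_pdivrMr//.
apply: le_trans (uC n) _; rewrite -ler_pdivrMl// mulrC.
by near: n; exact: nbhs_infty_ger.
Unshelve. all: by end_near. Qed.

Lemma fisher_natural_bounded (R : realType) (X : finType) (W g : X -> X -> R)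
    (P : R -> X -> R) (a : R -> X -> R) (theta : R) :
  (forall t : R, distribution (P t)) ->
  (forall x, derivable (P ^~ x) theta 1) ->
  (forall x x', is_derive theta 1 (fun t => exp_family W g t x x')
    (exp_family W g theta x x' * score W g a theta x x')) ->
  (forall s x', \sum_x exp_family W g s x x' = 1) ->
  (forall s x x', 0 <= exp_family W g s x x') ->
  (forall x', \sum_x exp_family W g theta x x' * score W g a theta x x' = 0) ->
  (forall x', \sum_x exp_family W g theta x x' *
    (score W g a theta x x' ^+ 2 + derive1 (a ^~ x) theta) =
    derive1 (expectation_param W g) theta + derive1 (a ^~ x') theta) ->
  exists C, forall n, `|fisher_natural W g P n theta -
    n%:R * derive1 (expectation_param W g) theta| <= C.
Proof.
move=> P1 dP VD V1 V0 mean0 poisson.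
set de := derive1 _ theta; pose b x := derive1 (a ^~ x) theta.
(* Where [P theta x = 0] this quotient is 0 by convention; paths starting there have probability
   0. *)
pose D x := derive1 (P ^~ x) theta / P theta x.
have P0 x : 0 <= P theta x by have [] := P1 theta.
pose K := \sum_x P theta x * (D x ^+ 2 + b x).
exists (`|K| + \sum_x `|b x|) => n.
pose q (w : n.+1.-tuple X) := markov_dist (exp_family W g theta) (P theta) w.
have q0 w : 0 <= q w by exact: markov_dist_ge0.
pose S (w : n.+1.-tuple X) := D (tnth w ord0) + path_sum (score W g a theta) w.
have -> : fisher_natural W g P n theta = \sum_w q w * S w ^+ 2.
  apply: fisher_information_score => // w qw.
  apply: is_derive_markov_dist => //.
  rewrite /D mulrCA mulfV ?mulr1 ?derive1E; last first.
    by apply: contraTneq qw => Pw; rewrite /markov_dist Pw mul0r ltxx.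
  exact: derivableP.
(* The second-moment formula with offset [D]: what remains is [K] from the initial state and the
   mean of [b] at the last state, both bounded uniformly in [n]. *)
have -> : \sum_w q w * S w ^+ 2 - n%:R * de =
    K - \sum_w q w * b (tnth w ord_max).
  have := path_second_moment n (P theta) D (V1 theta) mean0 poisson.
  rewrite -/de -/b.
  under eq_bigr do rewrite mulrDr.
  rewrite big_split/= => E.
  have {E} -> : \sum_w q w * S w ^+ 2 =
      \sum_x P theta x * (D x ^+ 2 + b x + n%:R * de) -
      \sum_w q w * b (tnth w ord_max) by rewrite -E addrK.
  have -> : \sum_x P theta x * (D x ^+ 2 + b x + n%:R * de) = K + n%:R * de.
    under eq_bigr do rewrite mulrDr.
    by rewrite big_split/= -mulr_suml (proj2 (P1 theta)) mul1r.
  by ring.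
apply: le_trans (ler_normB _ _) _; rewrite lerD2l.
apply: le_trans (ler_norm_sum _ _ _) _.
rewrite -[leRHS]mul1r -(proj2 (P1 theta)) -(markov_dist_sum n _ (V1 theta)).
rewrite mulr_suml; apply: ler_sum => w _.
rewrite normrM ger0_norm// ler_wpM2l//.
by rewrite (bigD1 (tnth w ord_max))//= lerDl sumr_ge0.
Qed.

(** * Change of parameter and the two limits *)

Lemma increasing_of_derive_gt0 (R : realType) (f : R -> R) :
  (forall s : R, derivable f s 1) -> (forall s : R, 0 < derive1 f s) ->
  {homo f : s t / s < t}.
Proof.
move=> df f0 s t st; apply: (@gtr0_derive1_incr _ f s t) => //.
apply: derivable_within_continuous => x _; exact: df.
Qed.

Lemma natural_param_ofK (R : realType) (X : finType) (W g : X -> X -> R) :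
  injective (expectation_param W g) ->
  cancel (expectation_param W g) (natural_param_of W g).
Proof.
move=> inj s; rewrite /natural_param_of.
by apply: xget_unique => [|t ts]; [reflexivity|exact: inj].
Qed.

Theorem lemma7p1 (R : realType) (X : finType) (W g : X -> X -> R)
    (W_transition : transition_matrix W)
    (W_irreducible : irreducible_kernel W)
    (W_ergodic : ergodic_kernel W)
    (g_independent : linearly_independent_under W g)
    (P : R -> X -> R)
    (P_distribution : forall t : R, distribution (P t))
    (P_smooth : forall x : X, smooth (fun t : R => P t x))
    (theta : R) :
  ((fun n : nat => fisher_natural W g P n theta / n%:R) @ \oo -->
     derive1n 2 (potential W g) theta) /\
  ((fun n : nat => fisher_expectation W g P n theta / n%:R) @ \oo -->
     (derive1n 2 (potential W g) theta)^-1).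
Proof.
(* On an empty state space every [g] is dependent, so a state [x0] exists. *)
have [x0 _|X0] := pickP (xpredT : pred X); last first.
  by exfalso; apply: g_independent; exists (fun=> 0), 0 => x; have := X0 x.
have [a [da deta VD V1 V0]] := exp_family_score g x0 W_transition W_irreducible.
have V_ge0 s x x' : 0 <= exp_family W g s x x' by have [] := V0 s x x'.
have V_gt0 s x x' : 0 < W x x' -> 0 < exp_family W g s x x'.
  by have [] := V0 s x x'.
have eta_gt0 s : 0 < derive1 (expectation_param W g) s.
  exact: (expectation_param_deriv_gt0 x0 W_transition W_irreducible da).
have dP x : derivable (P ^~ x) theta 1 by exact: (P_smooth x 0%N theta).
have [C JC] := fisher_natural_bounded P_distribution dP (VD theta) V1 V_ge0
  (score_mean0 VD V1 theta) (score_poisson da deta VD V1 theta).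
have -> : derive1n 2 (potential W g) theta =
    derive1 (expectation_param W g) theta by rewrite derive1nS derive1n1.
set de := derive1 _ theta in JC *.
have deN0 : de != 0 by rewrite gt_eqF// eta_gt0.
have J_cvg := cvg_affine_over_n JC; split => //.
have eta_mono := le_mono (increasing_of_derive_gt0 deta eta_gt0).
have etaK := natural_param_ofK (inc_inj eta_mono).
have eta_cont : continuous (expectation_param W g).
  by move=> s; apply/differentiable_continuous/derivable1_diffP; exact: deta.
(* The inverse function rule applies: [natural_param_of] is a left inverse of the continuous map
   [expectation_param], whose derivative [de] is nonzero. *)
have dtau : is_derive (expectation_param W g theta) 1
    (natural_param_of W g) de^-1.
  apply: is_derive_inverse; last exact: deN0.
  - by near=> s; exact: etaK.
  - by near=> s; exact: eta_cont.
  - by rewrite /de derive1E; exact: (derivableP (deta theta)).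
have JE n : fisher_expectation W g P n theta =
    de^-1 ^+ 2 * fisher_natural W g P n theta.
  have := fisher_information_comp
    (q := fun s => markov_dist (n := n) (exp_family W g s) (P s)) _ dtau.
  rewrite etaK; apply => w qw.
  apply: derivable_mulf; first exact: dP.
  by apply: derivable_bigprod => i; have [] := VD theta
    (tnth w (lift ord0 i)) (tnth w (widen_ord (leqnSn n) i)).
under eq_fun do rewrite JE -mulrA.
(* The chain rule contributes the inverse square of [de] and the first limit contributes [de]. *)
have limE : de^-1 ^+ 2 * de = de^-1 by rewrite expr2 -mulrA mulVf// mulr1.
rewrite -[X in nbhs X]limE; apply: cvgM; last exact: J_cvg.
exact: cvg_cst.
Unshelve. all: by end_near. Qed.
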